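(* Let $\mathcal{P}$ be a non-negative transition probability tensor of order $m$ and dimension $n$ with $\delta_m>\frac{m-2}{m-1}$, let $\eta_m=(1-\delta_m)(m-1)$, and let $\bar{x}$ be a solution of $x=\mathcal{P}x^{m-1}$, $x\ge 0$, $\|x\|_1=1$. Let $\beta>0$ satisfy $\beta<1-\eta_m$. Then, for any initial transition probability vector $x_0$, the iterative sequence $\{x_k\}$ generated by algorithm HOPMM-I with parameter $\beta$ has a convergent subsequence $\{x_{k_n}\}$ that converges to $\bar{x}$, i.e. $$\lim_{n\to\infty}x_{k_n}=\bar{x}.$$
   Context: Let $m\ge 2$, $n\ge 1$ and $\langle n\rangle=\{1,\dots,n\}$. An $m$th-order $n$-dimensional real tensor $\mathcal{P}=(p_{i_1i_2\cdots i_m})$, with $i_1,\dots,i_m\in\langle n\rangle$, is a (non-negative) transition probability tensor if $p_{i_1\cdots i_m}\ge 0$ for all indices and $\sum_{i_1=1}^n p_{i_1i_2\cdots i_m}=1$ for all $i_2,\dots,i_m$. A transition probability vector is a vector $x\in\mathbb{R}^n$ with $x\ge 0$ (entrywise) and $\sum_i x_i=1$. For $x\in\mathbb{R}^n$, the vector $\mathcal{P}x^{m-1}\in\mathbb{R}^n$ is defined by $$(\mathcal{P}x^{m-1})_i=\sum_{i_2,\ldots,i_m=1}^n p_{i i_2\cdots i_m}x_{i_2}\cdots x_{i_m},\quad i=1,\dots,n.$$ Define $$\delta_m=\min_{S\subset\langle n\rangle}\Big\{\min_{i_2,\ldots,i_m\in\langle n\rangle}\sum_{i\in S'}p_{i i_2\cdots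 i_m}+\min_{i_2,\ldots,i_m\in\langle n\rangle}\sum_{i\in S}p_{i i_2\cdots i_m}\Big\},$$ where $S$ ranges over subsets of $\langle n\rangle$ and $S'=\langle n\rangle\setminus S$. For $x\in\mathbb{R}^n$ let $x_+=\max(x,0)$ (entrywise) and $\mathrm{proj}(x)=x_+/\|x_+\|_1$ (when $x_+\neq 0$). Algorithm HOPMM-I (higher-order power method with momentum, parameter $\beta>0$), regarded as generating an infinite sequence (no stopping test): given $x_0$, for $k=1,2,3,\dots$ first set $x_k=\mathcal{P}x_{k-1}^{m-1}$. Periodically, namely at every 3rd step ($k=3,6,9,\dots$), then compute $\hat{x}_k=x_k+\beta(x_{k-1}-x_{k-2})$ and replace $x_k$ by $\mathrm{proj}(\hat{x}_k)$. *)

(* Defs.v *)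
From HB Require Import structures.
From mathcomp Require Import all_boot all_order all_algebra.
From mathcomp Require Import all_classical all_reals all_analysis.
Import Order.TTheory GRing.Theory Num.Theory.
Import numFieldNormedType.Exports.

Set Implicit Arguments.
Unset Strict Implicit.
Unset Printing Implicit Defensive.

Local Open Scope ring_scope.

(* The entry p_{i_1 i_2 ... i_m} is [p i_1 [tuple i_2; ...; i_m]]: the first
   index, which plays a special role throughout, is separated from the m - 1
   others. *)
Definition tensor (R : realType) (m n : nat) : Type :=
  'I_n -> m.-1.-tuple 'I_n -> R.

Definition transition_tensor (R : realType) (m n : nat)
    (P : tensor R m n) : Prop :=
  (forall i t, 0 <= P i t) /\ (forall t, \sum_(i < n) P i t = 1).

Definition nonneg_vector (R : realType) (n : nat) (x : 'rV[R]_n) : Prop :=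
  forall i, 0 <= x ord0 i.

Definition transition_vector (R : realType) (n : nat) (x : 'rV[R]_n) : Prop :=
  nonneg_vector x /\ \sum_(i < n) x ord0 i = 1.

Definition norm_l1 (R : realType) (n : nat) (x : 'rV[R]_n) : R :=
  \sum_(i < n) `|x ord0 i|.

Definition tensor_apply (R : realType) (m n : nat) (P : tensor R m n)
    (x : 'rV[R]_n) : 'rV[R]_n :=
  \row_(i < n) \sum_(t : m.-1.-tuple 'I_n)
    P i t * \prod_(j < m.-1) x ord0 (tnth t j).

(* The value at the arbitrary inhabitant [i0] only serves as the starting
   value of the iterated minimum; the result does not depend on [i0]. *)
Definition fin_min (R : realType) (I : finType) (i0 : I) (F : I -> R) : R :=
  \big[Num.min/F i0]_(i : I) F i.

Definition tail_min (R : realType) (m n : nat) (P : tensor R m n.+1)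
    (S : {set 'I_n.+1}) : R :=
  fin_min (nseq_tuple m.-1 (ord0 : 'I_n.+1)) (fun t => \sum_(i in S) P i t).

(* S ranges over all subsets, the empty and the full one included. *)
Definition delta_m (R : realType) (m n : nat) (P : tensor R m n.+1) : R :=
  fin_min (finset.set0 : {set 'I_n.+1})
    (fun S => tail_min P (~: S) + tail_min P S).

Definition eta_m (R : realType) (m n : nat) (P : tensor R m n.+1) : R :=
  (1 - delta_m P) * (m%:R - 1).

Definition pos_part (R : realType) (n : nat) (x : 'rV[R]_n) : 'rV[R]_n :=
  \row_(i < n) Num.max (x ord0 i) 0.

(* [proj_prob x = 0] when the positive part of x vanishes. *)
Definition proj_prob (R : realType) (n : nat) (x : 'rV[R]_n) : 'rV[R]_n :=
  (norm_l1 (pos_part x))^-1 *: pos_part x.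

(* [hopmm_I P beta x0 k] is the final value of x_k, i.e. after its possible
   replacement by the projected extrapolation. In the branch [3 %| k] one has
   k >= 3, so that [k1] and [k1.-1] are k - 1 and k - 2. *)
Fixpoint hopmm_I (R : realType) (m n : nat) (P : tensor R m n) (beta : R)
    (x0 : 'rV[R]_n) (k : nat) {struct k} : 'rV[R]_n :=
  if k is k1.+1 then
    let y := tensor_apply P (hopmm_I P beta x0 k1) in
    if (3 %| k1.+1)%N then
      proj_prob (y + beta *: (hopmm_I P beta x0 k1 - hopmm_I P beta x0 k1.-1))
    else y
  else x0.

(* Main.v *)
Require Import Defs.
From HB Require Import structures.
From mathcomp Require Import all_boot all_order all_algebra.
From mathcomp Require Import all_classical all_reals all_analysis.
From mathcomp Require Import ring lra.
Import Order.TTheory GRing.Theory Num.Theory.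
Import numFieldNormedType.Exports.

Set Implicit Arguments.
Unset Strict Implicit.
Unset Printing Implicit Defensive.

Local Open Scope classical_set_scope.
Local Open Scope ring_scope.

(** Write |.|_1 for the l1 norm and eta for [eta_m P].  Everything rests on
    two facts about vectors of total mass 1.

    - The map x |-> P x^(m-1) is eta-Lipschitz for |.|_1 on transition vectors
      ([norm_l1_tensor_apply_sub_le]).  The vector P x^(m-1) is the image of
      the product measure x^(m-1) on tuples under the stochastic kernel P.
      Product measures satisfy |x^(m-1) - y^(m-1)|_1 <= (m-1) |x - y|_1
      ([sum_norm_prod_tuple_sub_le]), and a kernel contracts differences of
      probability measures by its Dobrushin coefficient, here at most
      1 - delta: testing the image of a zero-mass measure g against the set S
      where that image is nonnegative amounts to integrating against g the
      function t |-> P(S | t), whose oscillation is at most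
      1 - tail_min S' - tail_min S <= 1 - delta.

    - [proj_prob] does not increase the l1 distance to a transition vector
      ([norm_l1_proj_prob_sub_le]): between vectors of equal mass this distance
      is twice the positive part of the difference, and passing from x to
      x_+ / |x_+|_1 only lowers that positive part because |x_+|_1 >= 1.

    Let e be the distance from x_(3j) to xbar.  The next two iterates are at
    distance at most eta e and eta^2 e, so x_(3j+3) is at distance at most
    (eta^3 + beta (eta^2 + eta)) e.  Since beta < 1 - eta the factor is less
    than eta^3 + (1 - eta) (eta^2 + eta) = eta when eta > 0 and is 0 when
    eta = 0; it is less than 1 in both cases, as delta > (m-2)/(m-1) means
    eta < 1.  Hence x_(3j) converges to xbar geometrically, which gives the
    subsequence. *)

(** * Finite signed measures of total mass zero *)

Lemma sum_norm_zero_mass (R : realDomainType) (I : finType) (z : I -> R) :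
  \sum_i z i = 0 -> \sum_i `|z i| = 2 * \sum_i Num.max (z i) 0.
Proof.
move=> z0; rewrite mulr_sumr -[RHS]subr0 -[X in _ - X]z0 -sumrB; apply: eq_bigr => i _.
by case: (leP (z i) 0) => zi; [rewrite ler0_norm//| rewrite gtr0_norm//]; ring.
Qed.

(** The duality between oscillation and l1 norm on zero-mass measures: [f] may
    be recentred at (a + b) / 2 without changing its integral, and then it is
    bounded by (b - a) / 2. *)
Lemma sum_mul_zero_mass_le (R : realFieldType) (I : finType) (f g : I -> R)
    (a b : R) :
  (forall i, a <= f i <= b) -> \sum_i g i = 0 ->
  2 * \sum_i f i * g i <= (b - a) * \sum_i `|g i|.
Proof.
move=> fab g0.
have <- : (b - a) * \sum_i `|g i| + (a + b) * \sum_i g i =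
    (b - a) * \sum_i `|g i| by rewrite g0 mulr0 addr0.
rewrite !mulr_sumr -big_split; apply: ler_sum => i _ /=; have /andP[af fb] := fab i.
by case: (leP 0 (g i)) => gi; [rewrite ger0_norm//| rewrite ltr0_norm//]; nra.
Qed.

(** * Product measures on tuples *)

Lemma sum_tupleS (R : nmodType) (I : finType) (k : nat)
    (F : k.+1.-tuple I -> R) :
  \sum_t F t = \sum_i \sum_(t : k.-tuple I) F [tuple of i :: t].
Proof.
rewrite pair_bigA /=.
rewrite (reindex (fun p : I * k.-tuple I => [tuple of p.1 :: p.2])) //=.
exists (fun t => (thead t, [tuple of behead t])) => [[i t] _|t _] /=.
  by congr pair; apply: val_inj.
by rewrite -tuple_eta.
Qed.

Lemma prod_tnth_cons (R : pzSemiRingType) (I : finType) (k : nat) (x : I -> R)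
    (i : I) (t : k.-tuple I) :
  \prod_(j < k.+1) x (tnth [tuple of i :: t] j) =
  x i * \prod_(j < k) x (tnth t j).
Proof. by rewrite big_ord_recl tnth0; under eq_bigr do rewrite tnthS. Qed.

Lemma sum_prod_tuple (R : comPzRingType) (I : finType) (k : nat) (x : I -> R) :
  \sum_i x i = 1 -> \sum_(t : k.-tuple I) \prod_(j < k) x (tnth t j) = 1.
Proof.
move=> x1; elim: k => [|k IH].
  rewrite (big_pred1 [tuple]) ?big_ord0 // => t /=.
  by apply/esym/eqP; apply: tuple0.
rewrite sum_tupleS -[RHS]x1; apply: eq_bigr => i _.
by under eq_bigr do rewrite prod_tnth_cons; rewrite -mulr_sumr IH mulr1.
Qed.

(** Replacing the factors of a product of probability measures one at a time
    costs the l1 distance of the two factors each time. *)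
Lemma sum_norm_prod_tuple_sub_le (R : realDomainType) (I : finType) (k : nat)
    (x y : I -> R) :
  (forall i, 0 <= x i) -> (forall i, 0 <= y i) ->
  \sum_i x i = 1 -> \sum_i y i = 1 ->
  \sum_(t : k.-tuple I)
    `|\prod_(j < k) x (tnth t j) - \prod_(j < k) y (tnth t j)|
  <= k%:R * \sum_i `|x i - y i|.
Proof.
move=> x0 y0 x1 y1; elim: k => [|k IH].
  by rewrite mul0r big1 // => t _; rewrite !big_ord0 subrr normr0.
rewrite sum_tupleS -natr1 mulrDl mul1r.
pose X (t : k.-tuple I) := \prod_(j < k) x (tnth t j).
pose Y (t : k.-tuple I) := \prod_(j < k) y (tnth t j).
apply: (@le_trans _ _
  (\sum_i (x i * \sum_t `|X t - Y t| + `|x i - y i| * \sum_t Y t))).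
  apply: ler_sum => i _; rewrite !mulr_sumr -big_split; apply: ler_sum => t _.
  rewrite !prod_tnth_cons -/(X t) -/(Y t) /=.
  have Y0 : 0 <= Y t by apply: prodr_ge0.
  have -> : x i * X t - y i * Y t = x i * (X t - Y t) + (x i - y i) * Y t.
    by ring.
  apply: le_trans (ler_normD _ _) _.
  by rewrite !normrM (ger0_norm (x0 i)) (ger0_norm Y0).
by rewrite big_split /= -!mulr_suml x1 mul1r sum_prod_tuple // mulr1 lerD2r.
Qed.

(** * The contraction property of the tensor *)

Lemma fin_min_le (R : realType) (I : finType) (i0 : I) (F : I -> R) (i : I) :
  fin_min i0 F <= F i.
Proof. exact: bigmin_le. Qed.

(** The empty set already gives the value 1. *)
Lemma delta_m_le1 (R : realType) (m n : nat) (P : tensor R m n.+1) :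
  transition_tensor P -> delta_m P <= 1.
Proof.
move=> [P0 P1]; apply: le_trans (fin_min_le _ _ finset.set0) _.
pose t := nseq_tuple m.-1 (ord0 : 'I_n.+1).
rewrite -[leRHS]addr0 lerD //; apply: le_trans (fin_min_le _ _ t) _.
  by rewrite -(P1 t) le_eqVlt; apply/orP; left; apply/eqP/eq_bigl => i; rewrite !inE.
by rewrite big1 // => i; rewrite inE.
Qed.

Lemma tensor_apply_transition (R : realType) (m n : nat) (P : tensor R m n)
    (x : 'rV[R]_n) :
  transition_tensor P -> transition_vector x ->
  transition_vector (tensor_apply P x).
Proof.
move=> [P0 P1] [x0 x1]; split=> [i|].
  by rewrite mxE; apply: sumr_ge0 => t _; rewrite mulr_ge0 // prodr_ge0.
under eq_bigr do rewrite mxE.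
rewrite exchange_big /= -[RHS](@sum_prod_tuple _ _ m.-1 _ x1).
by apply: eq_bigr => t _; rewrite -mulr_suml P1 mul1r.
Qed.

Lemma norm_l1_tensor_apply_sub_le (R : realType) (m n : nat)
    (P : tensor R m n.+1) (x y : 'rV[R]_n.+1) :
  (2 <= m)%N -> transition_tensor P ->
  transition_vector x -> transition_vector y ->
  norm_l1 (tensor_apply P x - tensor_apply P y) <= eta_m P * norm_l1 (x - y).
Proof.
move=> hm hP hx hy; have [P0 P1] := hP; have [x0 x1] := hx; have [y0 y1] := hy.
set z := _ - _.
have z0 : \sum_i z ord0 i = 0.
  have [_ hx1] := tensor_apply_transition hP hx.
  have [_ hy1] := tensor_apply_transition hP hy.
  by under eq_bigr do rewrite /z mxE [X in _ + X]mxE; rewrite sumrB hx1 hy1 subrr.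
rewrite /norm_l1 sum_norm_zero_mass //.
pose S := [set i | 0 <= z ord0 i]%SET.
pose g (t : m.-1.-tuple 'I_n.+1) :=
  \prod_(j < m.-1) x ord0 (tnth t j) - \prod_(j < m.-1) y ord0 (tnth t j).
have -> : \sum_i Num.max (z ord0 i) 0 = \sum_t (\sum_(i in S) P i t) * g t.
  transitivity (\sum_(i in S) z ord0 i).
    rewrite [RHS]big_mkcond; apply: eq_bigr => i _; rewrite inE.
    by case: leP.
  under [RHS]eq_bigr do rewrite mulr_suml.
  rewrite exchange_big; apply: eq_bigr => i _; rewrite !mxE -sumrB.
  by apply: eq_bigr => t _; rewrite -mulrBr.
have hf t : tail_min P S <= \sum_(i in S) P i t <= 1 - tail_min P (~: S)%SET.
  rewrite /tail_min fin_min_le lerBrDr -[leRHS](P1 t).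
  rewrite [leRHS](bigID (mem S)) lerD2l.
  apply: le_trans (fin_min_le _ _ t) _.
  by rewrite le_eqVlt; apply/orP; left; apply/eqP/eq_bigl => i; rewrite !inE.
have g0 : \sum_t g t = 0.
  by rewrite sumrB !(@sum_prod_tuple _ _ m.-1 (fun i => _ ord0 i)) // subrr.
apply: le_trans (sum_mul_zero_mass_le hf g0) _.
have hd : 1 - tail_min P (~: S)%SET - tail_min P S <= 1 - delta_m P.
  have := fin_min_le finset.set0
    (fun S => tail_min P (~: S)%SET + tail_min P S) S.
  rewrite -/(delta_m P); lra.
have hg := @sum_norm_prod_tuple_sub_le _ _ m.-1 _ _ x0 y0 x1 y1.
apply: le_trans (ler_wpM2r _ hd) _; first exact: sumr_ge0.
rewrite /eta_m -mulrA ler_wpM2l ?subr_ge0 ?delta_m_le1 //.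
under [X in _ * X]eq_bigr do rewrite !mxE.
by have <- : m.-1%:R = m%:R - 1 :> R by rewrite -subn1 natrB // ltnW.
Qed.

(** * The projection onto the simplex *)

Lemma norm_l1_pos_part_ge1 (R : realType) (n : nat) (x : 'rV[R]_n) :
  \sum_i x ord0 i = 1 -> 1 <= norm_l1 (pos_part x).
Proof.
move=> <-; apply: ler_sum => i _; rewrite mxE; apply: le_trans (ler_norm _).
by rewrite le_max lexx.
Qed.

Lemma proj_prob_transition (R : realType) (n : nat) (x : 'rV[R]_n) :
  \sum_i x ord0 i = 1 -> transition_vector (proj_prob x).
Proof.
move=> /norm_l1_pos_part_ge1 s1.
have s0 : 0 < norm_l1 (pos_part x) by lra.
have p0 i : 0 <= pos_part x ord0 i by rewrite mxE le_max lexx orbT.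
split=> [i|]; first by rewrite mxE mulr_ge0 // invr_ge0 ltW.
under eq_bigr do rewrite mxE; rewrite -mulr_sumr.
under eq_bigr do rewrite -(ger0_norm (p0 _)).
by rewrite mulVf // gt_eqF.
Qed.

Lemma norm_l1_proj_prob_sub_le (R : realType) (n : nat) (x y : 'rV[R]_n) :
  \sum_i x ord0 i = 1 -> transition_vector y ->
  norm_l1 (proj_prob x - y) <= norm_l1 (x - y).
Proof.
move=> x1 [y0 y1]; have [_ p1] := proj_prob_transition x1.
have s1 := norm_l1_pos_part_ge1 x1.
rewrite /norm_l1 !sum_norm_zero_mass; last 2 first.
- by under eq_bigr do rewrite !mxE; rewrite sumrB x1 y1 subrr.
- by under eq_bigr do rewrite mxE [X in _ + X]mxE; rewrite sumrB y1 p1 subrr.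
rewrite ler_pM2l //; apply: ler_sum => i _; rewrite !mxE.
have hp : (norm_l1 (pos_part x))^-1 * Num.max (x ord0 i) 0
    <= Num.max (x ord0 i) 0.
  by rewrite ler_piMl ?le_max ?lexx ?orbT // invf_le1 // (lt_le_trans _ s1).
have yi := y0 i; move: hp.
rewrite !maxEle; do ![case: ifP => /=]; lra.
Qed.

(** * The iteration *)

Lemma eta_m_ge0 (R : realType) (m n : nat) (P : tensor R m n.+1) :
  (2 <= m)%N -> transition_tensor P -> 0 <= eta_m P.
Proof.
move=> hm hP; rewrite mulr_ge0 ?subr_ge0 ?delta_m_le1 //.
by rewrite ler1n ltnW.
Qed.

Lemma eta_m_lt1 (R : realType) (m n : nat) (P : tensor R m n.+1) :
  (2 <= m)%N -> (m%:R - 2) / (m%:R - 1) < delta_m P -> eta_m P < 1.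
Proof.
move=> hm; have m2 : (2 : R) <= m%:R by rewrite ler_nat.
by rewrite ltr_pdivrMr /eta_m => [|]; lra.
Qed.

(** Mass 1 is all that [proj_prob] needs to return a transition vector, so the
    iteration stays in the simplex even when the extrapolation leaves it. *)
Lemma sum_extrapolation (R : realType) (n : nat) (beta : R)
    (x2 x1 x0 : 'rV[R]_n) :
  transition_vector x2 -> transition_vector x1 -> transition_vector x0 ->
  \sum_i (x2 + beta *: (x1 - x0)) ord0 i = 1.
Proof.
move=> [_ h2] [_ h1] [_ h0]; under eq_bigr do rewrite !mxE.
by rewrite big_split /= -mulr_sumr sumrB h0 h1 h2 subrr mulr0 addr0.
Qed.

Lemma hopmm_I_transition (R : realType) (m n : nat) (P : tensor R m n)
    (beta : R) (x0 : 'rV[R]_n) (k : nat) :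
  transition_tensor P -> transition_vector x0 ->
  transition_vector (hopmm_I P beta x0 k).
Proof.
move=> hP hx0; have [N] := ubnP k; elim: N k => // N IH [|k] //.
rewrite ltnS => kN; have hk := IH k kN.
have hk1 := IH k.-1 (leq_ltn_trans (leq_pred k) kN).
rewrite /=; case: ifP => _; last exact: tensor_apply_transition.
apply/proj_prob_transition/sum_extrapolation => //.
exact: tensor_apply_transition.
Qed.

Lemma norm_l1_extrapolation_sub_le (R : realType) (n : nat) (beta : R)
    (x2 x1 x0 y : 'rV[R]_n) :
  0 <= beta ->
  norm_l1 (x2 + beta *: (x1 - x0) - y) <=
  norm_l1 (x2 - y) + beta * (norm_l1 (x1 - y) + norm_l1 (x0 - y)).
Proof.
move=> b0; rewrite /norm_l1 -big_split mulr_sumr -big_split.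
apply: ler_sum => i _ /=; rewrite !mxE.
set a := x2 _ _; set b := x1 _ _; set c := x0 _ _; set d := y _ _.
have -> : a + beta * (b - c) - d = (a - d) + beta * ((b - d) - (c - d)) by ring.
apply: le_trans (ler_normD _ _) _; rewrite lerD2l normrM ger0_norm //.
by rewrite ler_wpM2l // ler_normB.
Qed.

(** The momentum term is built from the results of the two plain steps of the
    period, which are at distance eta^2 e and eta e from [xbar] when the period
    starts at distance e; this is why beta is multiplied by eta^2 + eta. *)
Lemma norm_l1_hopmm_I_period_le (R : realType) (m n : nat)
    (P : tensor R m n.+1) (beta : R) (x0 xbar : 'rV[R]_n.+1) (j : nat) :
  (2 <= m)%N -> transition_tensor P -> 0 <= beta ->
  transition_vector x0 -> transition_vector xbar ->
  xbar = tensor_apply P xbar ->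
  norm_l1 (hopmm_I P beta x0 (3 * j.+1) - xbar) <=
  (eta_m P ^+ 3 + beta * (eta_m P ^+ 2 + eta_m P)) *
    norm_l1 (hopmm_I P beta x0 (3 * j) - xbar).
Proof.
move=> hm hP b0 hx0 hxbar hfix.
have step x : transition_vector x ->
    norm_l1 (tensor_apply P x - xbar) <= eta_m P * norm_l1 (x - xbar).
  by move=> hx; rewrite [X in tensor_apply P x - X]hfix norm_l1_tensor_apply_sub_le.
have e0 := @eta_m_ge0 _ _ _ P hm hP.
have hT k := @hopmm_I_transition _ _ _ P beta x0 k hP hx0.
set x := hopmm_I P beta x0.
have -> : (3 * j.+1 = (3 * j).+3)%N by rewrite mulnS.
have dvd3 i : (3 %| i + 3 * j)%N = (3 %| i)%N by rewrite dvdn_addl ?dvdn_mulr.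
have E1 : x (3 * j).+1 = tensor_apply P (x (3 * j)%N).
  by rewrite /x /= (dvd3 1%N).
have E2 : x (3 * j).+2 = tensor_apply P (x (3 * j).+1).
  by rewrite /x [LHS]/= (dvd3 2%N).
have -> : x (3 * j).+3 = proj_prob (tensor_apply P (x (3 * j).+2)
    + beta *: (x (3 * j).+2 - x (3 * j).+1)).
  by rewrite {1}/x [LHS]/= (dvd3 3%N).
have h1 := step _ (hT (3 * j)%N); have h2 := step _ (hT (3 * j).+1).
have h3 := step _ (hT (3 * j).+2).
rewrite -/x -E1 in h1; rewrite -/x -E2 in h2; rewrite -/x in h3.
apply: (@le_trans _ _ _ _ _ (norm_l1_proj_prob_sub_le _ hxbar)).
  by apply: sum_extrapolation => //; apply: tensor_apply_transition.
apply: le_trans (@norm_l1_extrapolation_sub_le _ _ _ _ _ _ _ b0) _.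
set e := norm_l1 (x (3 * j)%N - xbar) in h1 *.
set e1 := norm_l1 (x (3 * j).+1 - xbar) in h1 h2 *.
set e2 := norm_l1 (x (3 * j).+2 - xbar) in h2 h3 *.
have h2' : e2 <= eta_m P ^+ 2 * e.
  by apply: le_trans h2 _; rewrite expr2 -mulrA ler_wpM2l.
have h3' : norm_l1 (tensor_apply P (x (3 * j).+2) - xbar) <= eta_m P ^+ 3 * e.
  by apply: le_trans h3 _; rewrite exprS -mulrA ler_wpM2l.
rewrite mulrDl -mulrA lerD // ler_wpM2l // mulrDl lerD //.
Qed.

Lemma normr_le_norm_l1 (R : realType) (n : nat) (x : 'rV[R]_n) :
  `|x| <= norm_l1 x.
Proof.
rewrite [leLHS]/Num.Def.normr /= mx_normrE; apply: bigmax_le => [|[i j] _] /=.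
  by apply: sumr_ge0.
rewrite ord1 /norm_l1 (bigD1 j) //= lerDl; exact: sumr_ge0.
Qed.

Lemma cvg_of_norm_l1_contraction (R : realType) (n : nat)
    (u : nat -> 'rV[R]_n.+1) (l : 'rV[R]_n.+1) (c : R) :
  0 <= c -> c < 1 ->
  (forall j, norm_l1 (u j.+1 - l) <= c * norm_l1 (u j - l)) ->
  u j @[j --> \oo] --> l.
Proof.
move=> c0 c1 hu.
have hb j : norm_l1 (u j - l) <= geometric (norm_l1 (u 0%N - l)) c j.
  elim: j => [|j IH] /=; first by rewrite expr0 mulr1.
  by apply: le_trans (hu j) _; rewrite exprS mulrCA ler_wpM2l.
have h0 : `|u j - l| @[j --> \oo] --> (0 : R).
  apply: (@squeeze_cvgr _ _ _ _ (fun=> 0)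
    (geometric (norm_l1 (u 0%N - l)) c)).
  - apply: nearW => j; rewrite normr_ge0 /=.
    exact: le_trans (normr_le_norm_l1 _) (hb j).
  - exact: cvg_cst.
  - by apply: cvg_geometric; rewrite ger0_norm.
by apply/subr_cvg0; apply: (norm_cvg0 h0).
Qed.

Theorem theorem1 (R : realType) (m n : nat) (hm : (2 <= m)%N)
    (P : tensor R m n.+1) (hP : transition_tensor P)
    (hdelta : (m%:R - 2) / (m%:R - 1) < delta_m P)
    (xbar : 'rV[R]_n.+1) (hfix : xbar = tensor_apply P xbar)
    (hpos : nonneg_vector xbar) (hnorm : norm_l1 xbar = 1)
    (beta : R) (hbeta0 : 0 < beta) (hbeta : beta < 1 - eta_m P)
    (x0 : 'rV[R]_n.+1) (hx0 : transition_vector x0) :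
  exists phi : nat -> nat,
    {homo phi : i j / (i < j)%N} /\
    hopmm_I P beta x0 (phi j) @[j --> \oo] --> xbar.
Proof.
have hxbar : transition_vector xbar.
  by split=> //; rewrite -hnorm; apply: eq_bigr => i _; rewrite ger0_norm.
have e0 := @eta_m_ge0 _ _ _ P hm hP.
have e1 := @eta_m_lt1 _ _ _ P hm hdelta.
have q0 : 0 <= eta_m P ^+ 2 + eta_m P by rewrite addr_ge0 // exprn_ge0.
exists (fun j => 3 * j)%N; split=> [i j|]; first by rewrite ltn_pmul2l.
apply: (@cvg_of_norm_l1_contraction _ _ _ _
  (eta_m P ^+ 3 + beta * (eta_m P ^+ 2 + eta_m P))).
- apply: addr_ge0; first exact: exprn_ge0.
  by apply: mulr_ge0 q0; apply: ltW.
- have : beta * (eta_m P ^+ 2 + eta_m P)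
      <= (1 - eta_m P) * (eta_m P ^+ 2 + eta_m P).
    by apply: (ler_wpM2r q0); apply: ltW.
  have -> : (1 - eta_m P) * (eta_m P ^+ 2 + eta_m P) = eta_m P - eta_m P ^+ 3.
    by ring.
  lra.
- by move=> j; apply: norm_l1_hopmm_I_period_le => //; apply: ltW.
Qed.
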